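(* Let $\alpha$ be a real number with $0<\alpha\le \pi/6$, and let $f_\alpha:S^3\to S^3$ be the map $f_\alpha(p)=p(\cos\alpha+i\sin\alpha)p^{-1}$. For $p\in S^3$ put $$\Sigma_p^3=\{(x,\ p\,x\,f_\alpha(p)^{-1}) : x\in S^3\}\subset S^3\times S^3.$$ Then the sets $\Sigma_p^3$, $p\in S^3$, form a fiberwise homogeneous fibration of $S^3\times S^3$ by great 3-spheres, and this fibration is distinct from any Hopf fibration of $S^3\times S^3$.
   Context: $S^3$ is identified with the unit sphere in the quaternions $\mathbb{H}$ (with standard imaginary units $i,j,k$), and all products are quaternionic. $S^3\times S^3$ carries the product of the round metrics; up to a homothety it is the Clifford torus in $S^7\subset\mathbb{R}^4\times\mathbb{R}^4$ whose factors are the spheres of radius $1/\sqrt2$ in the two $\mathbb{R}^4$ factors (the choice of scale is immaterial). A great 3-sphere in $S^3\times S^3$ is a subset which is a great 3-sphere of $S^7$ under this inclusion; equivalently, it is the graph of an isometry from the first $S^3$ factor to the second. A fibration of a manifold $M$ means a partition of $M$ into the fibers of a locally trivial fiber bundle with total space $M$. A fibration of a Riemannian manifold $(M,g)$ is fiberwise homogeneous if for any two fibers there is an isometry of $(M,g)$ taking fibers to fibers and taking the first given fiber to the second one. The standard Hopf fibration of $S^3\times S^3$ (the restriction to the Clifford torus of the Hopf fibration of $S^7$ by great 3-spheres) has fibers $H_v=\{(x,\ v\,x): x\in S^3\}$, $v\in S^3$. A Hopf fibration of $S^3\times S^3$ is the image of $\{H_v\}_{v\in S^3}$ under an isometry of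 the form $(x,y)\mapsto(a\,x\,b^{-1},\ c\,y\,d^{-1})$ with $a,b,c,d\in S^3$. *)

(* Defs.v *)
From HB Require Import structures.
From mathcomp Require Import all_boot all_order all_algebra.
From mathcomp Require Import all_classical all_reals all_analysis.

Set Implicit Arguments.
Unset Strict Implicit.
Unset Printing Implicit Defensive.

Import Order.TTheory GRing.Theory Num.Theory.
Import numFieldNormedType.Exports.

Local Open Scope classical_set_scope.
Local Open Scope ring_scope.

(** * Quaternions *)

Section Quaternions.
Variable R : realType.

(* (x 0 0, x 0 1, x 0 2, x 0 3) stands for x0 + x1 i + x2 j + x3 k. *)
Definition quat := 'rV[R]_4.

Definition mkq (a b c d : R) : quat := \row_(n < 4) [:: a; b; c; d]`_n.

Definition qdot (x y : quat) : R := \sum_(n < 4) x 0 n * y 0 n.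

Definition qmul (x y : quat) : quat := mkq
  (x 0 0 * y 0 0 - x 0 1 * y 0 1 - x 0 2 * y 0 2 - x 0 3 * y 0 3)
  (x 0 0 * y 0 1 + x 0 1 * y 0 0 + x 0 2 * y 0 3 - x 0 3 * y 0 2)
  (x 0 0 * y 0 2 - x 0 1 * y 0 3 + x 0 2 * y 0 0 + x 0 3 * y 0 1)
  (x 0 0 * y 0 3 + x 0 1 * y 0 2 - x 0 2 * y 0 1 + x 0 3 * y 0 0).

Definition qconj (x : quat) : quat := mkq (x 0 0) (- x 0 1) (- x 0 2) (- x 0 3).

Definition qinv (x : quat) : quat := (qdot x x)^-1 *: qconj x.

Definition S3 : set quat := [set x | qdot x x = 1].

End Quaternions.

Notation "x *q y" := (qmul x y) (at level 40, left associativity) : ring_scope.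

(** * Smooth maps between subsets of normed spaces *)

Section Smooth.
Variables (R : realType) (V W : normedModType R).

(* In finite dimension this is the usual class C^k on the open set U: all
   iterated directional derivatives of order at most k exist and are
   continuous. *)
Fixpoint Ck_on (k : nat) (U : set V) (f : V -> W) : Prop :=
  match k with
  | 0 => forall x, U x -> {for x, continuous f}
  | k'.+1 => (forall x, U x -> differentiable f x) /\
             (forall v : V, Ck_on k' U (fun x => 'd f x v))
  end.

Definition smooth_on (U : set V) (f : V -> W) : Prop :=
  forall k, Ck_on k U f.

Definition smooth_extension_at (M : set V) (f : V -> W) (z : V) (g : V -> W) :=
  exists U : set V, [/\ open_nbhs z U, smooth_on U g &
    forall w, U w -> M w -> g w = f w].

Definition smooth_map (M : set V) (f : V -> W) : Prop :=
  forall z, M z -> exists g, smooth_extension_at M f z g.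

End Smooth.

(** * Fibrations *)

Section Fibrations.

(* [pi], restricted to the subspace [M] of [T], is a locally trivial fiber
   bundle over [B] with fiber [F]: over a neighbourhood [U] of any point of [B],
   [h] is a homeomorphism onto [U * F], with inverse [k], which commutes with
   the projections to [U].  Bundles are taken in the topological category: for
   alpha = pi/6 the sets Sigma_p are not the fibers of a smooth bundle, because
   p |-> p x (f_alpha p)^-1 is then, for each x, a homeomorphism of S^3 whose
   differential is singular at points p that vary with x.  The values of [pi], [h] and [k] outside of their
   domains are irrelevant. *)
Definition locally_trivial_bundle (T B F : topologicalType) (M : set T)
    (pi : T -> B) : Prop :=
  [/\ {within M, continuous pi}, pi @` M = [set: B] &
   forall b : B, exists U : set B, open_nbhs b U /\
   exists (h : T -> B * F) (k : B * F -> T),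
   let D := M `&` pi @^-1` U in
   let E := U `*` [set: F] in
   [/\ {within D, continuous h}, {within E, continuous k},
       set_fun D E h /\ set_fun E D k,
       {in D, cancel h k} /\ {in E, cancel k h} &
       forall z, D z -> (h z).1 = pi z]].

Definition is_fibration (T : topologicalType) (M : set T)
    (Fib : set (set T)) : Prop :=
  exists (B F : topologicalType) (pi : T -> B),
    locally_trivial_bundle F M pi /\
    Fib = [set M `&` pi @^-1` [set b] | b in [set: B]].

End Fibrations.

(** * The Riemannian manifold S^3 x S^3 *)

Section SphereProduct.
Variable R : realType.

Definition H2 := (quat R * quat R)%type.

Definition S3xS3 : set H2 := @S3 R `*` @S3 R.

Definition dot2 (z w : H2) : R := qdot z.1 w.1 + qdot z.2 w.2.

Definition tangent_S3xS3 (z v : H2) : Prop :=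
  qdot z.1 v.1 = 0 /\ qdot z.2 v.2 = 0.

(* The differential of [phi] at [z] is computed with a smooth extension [g] of
   [phi] near [z]; on tangent vectors it does not depend on [g]. *)
Definition preserves_metric (phi : H2 -> H2) : Prop :=
  forall z, S3xS3 z -> exists g, smooth_extension_at S3xS3 phi z g /\
    forall u v, tangent_S3xS3 z u -> tangent_S3xS3 z v ->
      dot2 ('d g z u) ('d g z v) = dot2 u v.

Definition diffeo_S3xS3 (phi : H2 -> H2) : Prop :=
  exists psi : H2 -> H2,
    [/\ smooth_map S3xS3 phi, smooth_map S3xS3 psi,
        set_fun S3xS3 S3xS3 phi /\ set_fun S3xS3 S3xS3 psi,
        {in S3xS3, cancel phi psi} & {in S3xS3, cancel psi phi}].

Definition isometry_S3xS3 (phi : H2 -> H2) : Prop :=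
  diffeo_S3xS3 phi /\ preserves_metric phi.

Definition fiberwise_homogeneous (Fib : set (set H2)) : Prop :=
  forall A B, Fib A -> Fib B -> exists phi : H2 -> H2,
    [/\ isometry_S3xS3 phi, forall C, Fib C -> Fib (phi @` C) & phi @` A = B].

(* A great 3-sphere of S^7 is the intersection of S^7 with a linear subspace of
   dimension 4. *)
Definition great_S3_in_S7 (A : set H2) : Prop :=
  exists W : {vspace H2}, \dim W = 4%N /\
    A = [set w | dot2 w w = 1 /\ w \in W].

Definition clifford (z : H2) : H2 := (Num.sqrt 2)^-1 *: z.

Definition great_S3 (A : set H2) : Prop :=
  A `<=` S3xS3 /\ great_S3_in_S7 (clifford @` A).

(** * Hopf fibrations *)

Definition hopf_fiber (v : quat R) : set H2 :=
  [set (x, v *q x) | x in @S3 R].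

Definition standard_hopf : set (set H2) :=
  [set hopf_fiber v | v in @S3 R].

Definition two_sided (a b c d : quat R) (z : H2) : H2 :=
  (a *q z.1 *q qinv b, c *q z.2 *q qinv d).

Definition is_hopf_fibration (Fib : set (set H2)) : Prop :=
  exists a b c d, [/\ S3 a, S3 b, S3 c, S3 d &
    Fib = [set two_sided a b c d @` A | A in standard_hopf]].

(** * The fibers Sigma_p *)

Definition f_alpha (alpha : R) (p : quat R) : quat R :=
  p *q mkq (cos alpha) (sin alpha) 0 0 *q qinv p.

Definition Sigma (alpha : R) (p : quat R) : set H2 :=
  [set (x, p *q x *q qinv (f_alpha alpha p)) | x in @S3 R].

End SphereProduct.

(* Main.v *)
(* Write f(p) = p e p^-1 with e = cos alpha + i sin alpha.  With r = q^-1 p,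
   |p - q|^2 = 2 - 2 r0 while |f(p) - f(q)|^2 <= 1 - r0^2, because
   sin alpha <= 1/2; hence d = |p - q| satisfies |f(p) - f(q)| <= d - d^3 / 8.
   So for all x and y in S^3 the map p |-> y f(p) x^-1 strictly decreases
   distances on the compact S^3.  It has a unique fixed point, which is the
   unique p such that (x, y) is in Sigma_p, and the cubic estimate shows that
   p depends continuously on (x, y): the bundle is globally trivial, with
   trivialization (x, y) |-> (p, x).
   The isometry (x, y) |-> (x g^-1, g y g^-1) maps Sigma_p to Sigma_(g p).
   In a Hopf fibration the fibers are the sets {(x, u x w^-1)} with a fixed w;
   comparing with Sigma_p forces f(p) = +-w for all p, which fails for
   p = 1 and p = j. *)

Require Import Defs.
From HB Require Import structures.
From mathcomp Require Import all_boot all_order all_algebra.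
From mathcomp Require Import all_classical all_reals all_analysis.
From mathcomp Require Import ring lra.
Set Implicit Arguments.
Unset Strict Implicit.
Unset Printing Implicit Defensive.

Import Order.TTheory GRing.Theory Num.Theory.
Import numFieldNormedType.Exports.
Local Open Scope classical_set_scope.
Local Open Scope ring_scope.

(** * Quaternion algebra *)

Section QuaternionAlgebra.
Variable R : realType.
Implicit Types (x y z p t : quat R) (k : R).

Lemma mkqE (a b c d : R) :
  ((mkq a b c d 0 0 = a) * (mkq a b c d 0 1 = b) *
   (mkq a b c d 0 2 = c) * (mkq a b c d 0 3 = d))%type.
Proof. by rewrite /mkq !mxE. Qed.

Lemma quatP x y : x 0 0 = y 0 0 -> x 0 1 = y 0 1 ->
  x 0 2 = y 0 2 -> x 0 3 = y 0 3 -> x = y.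
Proof.
move=> e0 e1 e2 e3; apply/rowP => -[[|[|[|[|//]]]] lti].
- by rewrite (_ : Ordinal lti = 0) //; apply: val_inj.
- by rewrite (_ : Ordinal lti = 1) //; apply: val_inj.
- by rewrite (_ : Ordinal lti = 2) //; apply: val_inj.
- by rewrite (_ : Ordinal lti = 3) //; apply: val_inj.
Qed.

Lemma qdotE x y : qdot x y =
  x 0 0 * y 0 0 + x 0 1 * y 0 1 + x 0 2 * y 0 2 + x 0 3 * y 0 3.
Proof.
rewrite /qdot !big_ord_recl big_ord0 addr0 !addrA.
by congr (_ * _ + _ * _ + _ * _ + _ * _); congr (_ 0 _); apply: val_inj.
Qed.

Definition q1 : quat R := mkq 1 0 0 0.

Ltac qring := apply: quatP; rewrite /qmul /qconj /q1 ?(mkqE, mxE); ring.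
Ltac dring := rewrite !qdotE /qmul /qconj /q1 ?(mkqE, mxE); ring.

Lemma qmulA x y z : x *q (y *q z) = x *q y *q z.
Proof. qring. Qed.

Lemma qmul1q x : q1 *q x = x.
Proof. qring. Qed.

Lemma qmulq1 x : x *q q1 = x.
Proof. qring. Qed.

Lemma qmulDl x y z : (x + y) *q z = x *q z + y *q z.
Proof. qring. Qed.

Lemma qmulDr x y z : z *q (x + y) = z *q x + z *q y.
Proof. qring. Qed.

Lemma qmulBl x y z : (x - y) *q z = x *q z - y *q z.
Proof. qring. Qed.

Lemma qmulBr x y z : z *q (x - y) = z *q x - z *q y.
Proof. qring. Qed.

Lemma qmulZl k x z : (k *: x) *q z = k *: (x *q z).
Proof. qring. Qed.

Lemma qmulZr k x z : z *q (k *: x) = k *: (z *q x).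
Proof. qring. Qed.

Lemma qconjM x y : qconj (x *q y) = qconj y *q qconj x.
Proof. qring. Qed.

Lemma qconjK x : qconj (qconj x) = x.
Proof. qring. Qed.

Lemma qconjB x y : qconj (x - y) = qconj x - qconj y.
Proof. qring. Qed.

Lemma qmulqV x : x *q qconj x = qdot x x *: q1.
Proof. rewrite qdotE; qring. Qed.

Lemma qmulVq x : qconj x *q x = qdot x x *: q1.
Proof. rewrite qdotE; qring. Qed.

Lemma qdotMl p x y : qdot (p *q x) (p *q y) = qdot p p * qdot x y.
Proof. dring. Qed.

Lemma qdotMr p x y : qdot (x *q p) (y *q p) = qdot p p * qdot x y.
Proof. dring. Qed.

Lemma qdot_conj x : qdot (qconj x) (qconj x) = qdot x x.
Proof. dring. Qed.

Lemma qdotZ k x : qdot (k *: x) (k *: x) = k ^+ 2 * qdot x x.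
Proof. dring. Qed.

Lemma qdotN x : qdot (- x) (- x) = qdot x x.
Proof. dring. Qed.

Lemma qdot_ge0 x : 0 <= qdot x x.
Proof. by rewrite qdotE !addr_ge0 // -expr2 sqr_ge0. Qed.

Lemma qdot_eq0 x : qdot x x = 0 -> x = 0.
Proof.
rewrite qdotE => e; apply: quatP; rewrite mxE; nra.
Qed.

(** [qdot x y] is the real coordinate of [x *q qconj y], and the squared norm of that product is the
    right-hand side. *)
Lemma Cauchy_Schwarz_qdot x y : qdot x y ^+ 2 <= qdot x x * qdot y y.
Proof.
have -> : qdot x x * qdot y y = qdot (x *q qconj y) (x *q qconj y).
  by rewrite qdotMl qdot_conj.
rewrite [X in _ <= X]qdotE.
have -> : (x *q qconj y) 0 0 = qdot x y.
  by rewrite qdotE /qmul /qconj !mkqE; ring.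
by rewrite -expr2 -!addrA lerDl !addr_ge0 // -expr2 sqr_ge0.
Qed.

Lemma S3_1 : S3 q1.
Proof. by rewrite /S3 /= qdotE /q1 !mkqE; ring. Qed.

Lemma S3M x y : S3 x -> S3 y -> S3 (x *q y).
Proof. by rewrite /S3 /= qdotMl => -> ->; rewrite mul1r. Qed.

Lemma S3V x : S3 x -> S3 (qconj x).
Proof. by rewrite /S3 /= qdot_conj. Qed.

Lemma qinvE x : S3 x -> qinv x = qconj x.
Proof. by rewrite /S3 /= /qinv => ->; rewrite invr1 scale1r. Qed.

Lemma S3_mulqV x : S3 x -> x *q qconj x = q1.
Proof. by rewrite /S3 /= qmulqV => ->; rewrite scale1r. Qed.

Lemma S3_mulVq x : S3 x -> qconj x *q x = q1.
Proof. by rewrite /S3 /= qmulVq => ->; rewrite scale1r. Qed.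

Lemma S3_mulqK x y : S3 y -> x *q y *q qconj y = x.
Proof. by move=> yS; rewrite -qmulA S3_mulqV // qmulq1. Qed.

Lemma S3_mulqVK x y : S3 y -> x *q qconj y *q y = x.
Proof. by move=> yS; rewrite -qmulA S3_mulVq // qmulq1. Qed.

Lemma S3_mulKq x y : S3 y -> qconj y *q (y *q x) = x.
Proof. by move=> yS; rewrite qmulA S3_mulVq // qmul1q. Qed.

Lemma S3_mulVKq x y : S3 y -> y *q (qconj y *q x) = x.
Proof. by move=> yS; rewrite qmulA S3_mulqV // qmul1q. Qed.

(** Commuting with i and j alone already makes each imaginary coordinate of [t] equal to its own
    opposite. *)
Lemma central_quat t :
  (forall x, S3 x -> t *q x = x *q t) -> t = t 0 0 *: q1.
Proof.
move=> tC.
have iS : S3 (mkq 0 1 0 0 : quat R) by rewrite /S3 /= qdotE !mkqE; ring.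
have jS : S3 (mkq 0 0 1 0 : quat R) by rewrite /S3 /= qdotE !mkqE; ring.
have t1 := congr1 (fun x : quat R => x 0 3) (tC _ jS).
have t2 := congr1 (fun x : quat R => x 0 3) (tC _ iS).
have t3 := congr1 (fun x : quat R => x 0 2) (tC _ iS).
move: t1 t2 t3.
cbv beta; rewrite /qmul !mkqE => t1 t2 t3.
by apply: quatP; rewrite /q1 ?(mkqE, mxE); lra.
Qed.

(** The Euclidean norm: multiplicative on quaternions, unlike the ambient matrix norm, which is the
    maximum of the absolute values of the coordinates. *)
Definition qnorm x := Num.sqrt (qdot x x).

Lemma qnorm_ge0 x : 0 <= qnorm x.
Proof. exact: sqrtr_ge0. Qed.

Lemma sqr_qnorm x : qnorm x ^+ 2 = qdot x x.
Proof. by rewrite sqr_sqrtr // qdot_ge0. Qed.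

Lemma qnormD x y : qnorm (x + y) <= qnorm x + qnorm y.
Proof.
rewrite -(ler_pXn2r (n := 2)) ?nnegrE ?addr_ge0 ?qnorm_ge0 //.
have xy : qdot x y <= qnorm x * qnorm y.
  apply: le_trans (ler_norm _) _.
  rewrite -(ler_pXn2r (n := 2)) ?nnegrE ?mulr_ge0 ?qnorm_ge0 //.
  by rewrite real_normK ?num_real // exprMn !sqr_qnorm Cauchy_Schwarz_qdot.
rewrite sqrrD !sqr_qnorm.
have -> : qdot (x + y) (x + y) = qdot x x + qdot x y *+ 2 + qdot y y by dring.
by rewrite lerD2r lerD2l lerMn2r.
Qed.

Lemma qnormN x : qnorm (- x) = qnorm x.
Proof. by rewrite /qnorm qdotN. Qed.

Lemma qnormMl p x : S3 p -> qnorm (p *q x) = qnorm x.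
Proof. by rewrite /S3 /= /qnorm qdotMl => ->; rewrite mul1r. Qed.

Lemma qnormMr p x : S3 p -> qnorm (x *q p) = qnorm x.
Proof. by rewrite /S3 /= /qnorm qdotMr => ->; rewrite mul1r. Qed.

Lemma qnorm_conj x : qnorm (qconj x) = qnorm x.
Proof. by rewrite /qnorm qdot_conj. Qed.

Lemma normr_coord m n (A : 'M[R]_(m, n)) i j : `|A i j| <= `|A|.
Proof.
rewrite [leRHS]/Num.norm /= mx_normrE.
by apply/bigmax_geP; right; exists (i, j).
Qed.

Lemma normr_le_qnorm x : `|x| <= qnorm x.
Proof.
rewrite [leLHS]/Num.norm /= mx_normrE; apply/bigmax_leP; split.
  exact: qnorm_ge0.
move=> [i j] _ /=; rewrite (ord1 i) -(ler_pXn2r (n := 2)) ?nnegrE ?qnorm_ge0 //.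
rewrite real_normK ?num_real // sqr_qnorm /qdot (bigD1 j) //= -expr2 lerDl.
by apply: sumr_ge0 => n _; rewrite -expr2 sqr_ge0.
Qed.

(** Each of the four squared coordinates is at most the squared maximum; 2 is the square root of
    4. *)
Lemma qnorm_le_normr x : qnorm x <= 2 * `|x|.
Proof.
rewrite -(ler_pXn2r (n := 2)) ?nnegrE ?mulr_ge0 ?qnorm_ge0 //.
rewrite sqr_qnorm qdotE exprMn.
have coord i : x 0 i * x 0 i <= `|x| ^+ 2.
  by rewrite -expr2 -real_normK ?num_real // ler_pXn2r ?nnegrE // normr_coord.
have := coord 0; have := coord 1; have := coord 2; have := coord 3; lra.
Qed.

End QuaternionAlgebra.

(** * The contraction estimate *)

Section Contraction.
Variables (R : realType) (c s : R).
Implicit Types (x y z p q r : quat R).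

Let e : quat R := mkq c s 0 0.
(** For unit [p], and with [c], [s] the cosine and sine of alpha, this is [f_alpha]; conjugation
    replaces inversion, so the formula is polynomial in the coordinates. *)
Definition conj_axis p := p *q mkq c s 0 0 *q qconj p.
(** The map whose graph over the sphere is the fiber of a unit [p]. *)
Definition fiber_map p x := p *q x *q qconj (conj_axis p).

Hypotheses (cs1 : c ^+ 2 + s ^+ 2 = 1) (s_le : s ^+ 2 <= 1 / 4).

Lemma S3_axis : S3 e.
Proof. by rewrite /S3 /= qdotE /e !mkqE -[RHS]cs1; ring. Qed.

Lemma S3_conj_axis p : S3 p -> S3 (conj_axis p).
Proof. by move=> pS; apply: S3M (S3V pS); apply: S3M S3_axis. Qed.

Lemma S3_fiber_map p x : S3 p -> S3 x -> S3 (fiber_map p x).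
Proof. by move=> pS xS; apply/S3M/S3V/S3_conj_axis; first exact: S3M. Qed.

(** Turns y = [fiber_map p x] into the fixed-point equation p = y f(p) x^-1, from which uniqueness
    and continuity of p are derived. *)
Lemma fiber_mapK p x : S3 p -> S3 x ->
  fiber_map p x *q conj_axis p *q qconj x = p.
Proof.
by move=> pS xS; rewrite /fiber_map S3_mulqVK ?S3_mulqK //; exact: S3_conj_axis.
Qed.

(* With r = q^-1 p, both sides are functions of r: the left one is
   |r e - e r|^2 = 4 s^2 (r2^2 + r3^2), and the right one is 1 - r0^2. *)
Lemma sqr_dist_conj_axis p q : S3 p -> S3 q ->
  qdot (conj_axis p - conj_axis q) (conj_axis p - conj_axis q) <=
  qdot (p - q) (p - q) - qdot (p - q) (p - q) ^+ 2 / 4.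
Proof.
move=> pS qS; set r := qconj q *q p.
have rS : S3 r by apply/S3M => //; apply: S3V.
have pE : p = q *q r by rewrite S3_mulVKq.
have -> : qdot (p - q) (p - q) = qdot (r - @q1 R) (r - @q1 R).
  rewrite pE -{2 4}(qmulq1 q) -qmulBr qdotMl; move: qS; rewrite /S3 /= => ->.
  by rewrite mul1r.
have -> : conj_axis p - conj_axis q =
    q *q ((r *q e - e *q r) *q qconj r) *q qconj q.
  by rewrite pE /conj_axis -/e qconjM qmulBl S3_mulqK // qmulBr qmulBl !qmulA.
rewrite qdotMr qdotMl qdotMr !qdot_conj.
move: rS qS; rewrite /S3 /= => rS ->; rewrite !(rS, mul1r).
have d2E : qdot (r - @q1 R) (r - @q1 R) = 2 - 2 * r 0 0.
  by rewrite -[2 in RHS]/(1 + 1) -{1}rS !qdotE /q1 ?(mkqE, mxE); ring.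
rewrite d2E; have -> : 2 - 2 * r 0 0 - (2 - 2 * r 0 0) ^+ 2 / 4 =
    r 0 1 ^+ 2 + (r 0 2 ^+ 2 + r 0 3 ^+ 2).
  by transitivity (1 - r 0 0 ^+ 2); [field | rewrite -rS qdotE; ring].
have -> : qdot (r *q e - e *q r) (r *q e - e *q r) =
    4 * s ^+ 2 * (r 0 2 ^+ 2 + r 0 3 ^+ 2).
  by rewrite qdotE /qmul /e ?(mkqE, mxE); ring.
(* The bound on [s] brings the left side below r2^2 + r3^2; the term r1^2 on the right is slack. *)
have ss_le1 : 4 * s ^+ 2 <= 1 by move: s_le; lra.
apply: ler_wpDl; first exact: sqr_ge0.
by rewrite ler_piMl ?addr_ge0 ?sqr_ge0.
Qed.

Lemma sqr_dist_conj_axis_lt p q : S3 p -> S3 q -> p <> q ->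
  qdot (conj_axis p - conj_axis q) (conj_axis p - conj_axis q) <
  qdot (p - q) (p - q).
Proof.
move=> pS qS pq; apply: le_lt_trans (sqr_dist_conj_axis pS qS) _.
rewrite gtrBl divr_gt0 // exprn_gt0 // lt_def qdot_ge0 andbT.
by apply/eqP => /qdot_eq0/eqP; rewrite subr_eq0 => /eqP.
Qed.

(** The square of d - d^3/8 is d^2 - d^4/4 + d^6/64, which exceeds the bound of [sqr_dist_conj_axis]
    by d^6/64. *)
Lemma qnorm_conj_axisB p q : S3 p -> S3 q ->
  qnorm (conj_axis p - conj_axis q) <= qnorm (p - q) - qnorm (p - q) ^+ 3 / 8.
Proof.
move=> pS qS; have := sqr_dist_conj_axis pS qS.
rewrite -!sqr_qnorm; set d := qnorm (p - q) => le_d.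
have d_ge0 : 0 <= d := qnorm_ge0 _.
(* The diameter bound makes d - d^3/8 nonnegative, so that squares may be compared. *)
have d_le2 : d <= 2.
  apply: le_trans (qnormD _ _) _; rewrite qnormN /qnorm.
  by move: pS qS; rewrite /S3 /= => -> ->; rewrite sqrtr1.
have dd_le4 : d ^+ 2 <= 4.
  by rewrite -[4]/(2 * 2)%:R natrM -expr2 ler_pXn2r ?nnegrE.
rewrite -(ler_pXn2r (n := 2)) ?nnegrE ?qnorm_ge0 //; last first.
  rewrite exprSr mulrAC subr_ge0 ler_piMl //; lra.
apply: le_trans le_d _; have : 0 <= d ^+ 6 by rewrite exprn_ge0.
lra.
Qed.

(** A Hölder estimate of exponent 1/3 for p as a function of the point (x, y). It yields uniqueness
    of the fiber through a point when both points coincide, and continuity of the projection in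
    general. *)
Lemma qnorm_fiber_map_inverse_bound p q x z : S3 p -> S3 q -> S3 x -> S3 z ->
  qnorm (p - q) ^+ 3 <=
  8 * (qnorm (x - z) + qnorm (fiber_map p x - fiber_map q z)).
Proof.
move=> pS qS xS zS; set y := fiber_map p x; set w := fiber_map q z.
have wS : S3 w by apply: S3_fiber_map.
have fpS := S3_conj_axis pS; have fqS := S3_conj_axis qS.
(* The difference of the two fixed-point equations telescopes, one factor changing at a time. In the
   resulting bound [qnorm (p - q)] occurs on both sides and cancels, leaving the cubic term. *)
have pqE : p - q = (y - w) *q conj_axis p *q qconj x +
    w *q (conj_axis p - conj_axis q) *q qconj x +
    w *q conj_axis q *q qconj (x - z).
  rewrite -{1}(fiber_mapK pS xS) -{1}(fiber_mapK qS zS) -/y -/w.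
  rewrite qconjB !(qmulBl, qmulBr) !subrKA.
  reflexivity.
have : qnorm (p - q) <= qnorm (y - w) +
    (qnorm (p - q) - qnorm (p - q) ^+ 3 / 8) + qnorm (x - z).
  rewrite {1}pqE; apply: le_trans (qnormD _ _) _; apply: lerD.
    apply: le_trans (qnormD _ _) _; apply: lerD.
      by rewrite !qnormMr //; apply: S3V.
    rewrite qnormMr; last exact: S3V.
    by rewrite qnormMl //; apply: qnorm_conj_axisB.
  by rewrite qnormMl ?qnorm_conj //; apply: S3M.
lra.
Qed.

Lemma fiber_map_inj p q x : S3 p -> S3 q -> S3 x ->
  fiber_map p x = fiber_map q x -> p = q.
Proof.
move=> pS qS xS pqx; have := qnorm_fiber_map_inverse_bound pS qS xS xS.
rewrite pqx !subrr; have -> : qnorm (0 : quat R) = 0.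
  by rewrite /qnorm qdotE !mxE !mulr0 !addr0 sqrtr0.
rewrite addr0 mulr0 => d3.
have /eqP d0 : qnorm (p - q) == 0.
  have : qnorm (p - q) ^+ 3 == 0 by rewrite eq_le d3 exprn_ge0 ?qnorm_ge0.
  by rewrite expf_eq0.
apply/eqP; rewrite -subr_eq0; apply/eqP/qdot_eq0.
by rewrite -sqr_qnorm d0 expr0n.
Qed.

End Contraction.

(** * Continuity and fixed points *)

Section Continuity.
Variables (R : realType) (T : topologicalType).
Implicit Types (t : T) (f g : T -> quat R).

Lemma continuous_mx m n (f : T -> 'M[R]_(m, n)) t :
  (forall i j, {for t, continuous (fun u => f u i j)}) -> {for t, continuous f}.
Proof.
move=> cf; apply/cvg_ballP => e e0.
have : \forall u \near t, forall ij, ball (f t ij.1 ij.2) e (f u ij.1 ij.2).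
  apply: filter_forall => -[i j] /=.
  by have /cvg_ballP/(_ _ e0) := cf i j.
by apply: filterS => u H; split => // i j; exact: (H (i, j)).
Qed.

Lemma continuous_coord m n (f : T -> 'M[R]_(m, n)) t i j :
  {for t, continuous f} -> {for t, continuous (fun u => f u i j)}.
Proof.
move=> cf; apply: (@continuous_comp _ _ _ f (fun M => M i j)) => //.
exact: coord_continuous.
Qed.

Lemma continuous_mkq (a b c d : T -> R) t :
  {for t, continuous a} -> {for t, continuous b} ->
  {for t, continuous c} -> {for t, continuous d} ->
  {for t, continuous (fun u => mkq (a u) (b u) (c u) (d u))}.
Proof.
move=> ca cb cc cd; apply: continuous_mx => i -[[|[|[|[|//]]]] lti];
  by rewrite /prop_for /continuous_at; under eq_fun do rewrite mxE; rewrite mxE.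
Qed.

Lemma continuous_qmul f g t : {for t, continuous f} -> {for t, continuous g} ->
  {for t, continuous (fun u => f u *q g u)}.
Proof.
move=> cf cg.
have cM i j : {for t, continuous ((fun u => f u 0 i) \* (fun u => g u 0 j))}.
  by apply: continuousM; exact: continuous_coord.
apply: continuous_mkq.
- exact: (continuousB (continuousB (continuousB (cM _ _) (cM _ _)) (cM _ _))
    (cM _ _)).
- exact: (continuousB (continuousD (continuousD (cM _ _) (cM _ _)) (cM _ _))
    (cM _ _)).
- exact: (continuousD (continuousD (continuousB (cM _ _) (cM _ _)) (cM _ _))
    (cM _ _)).
- exact: (continuousD (continuousB (continuousD (cM _ _) (cM _ _)) (cM _ _))
    (cM _ _)).
Qed.

Lemma continuous_qconj f t : {for t, continuous f} ->
  {for t, continuous (fun u => qconj (f u))}.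
Proof.
move=> cf; have cc i : {for t, continuous (fun u => f u 0 i)}.
  exact: continuous_coord.
by apply: continuous_mkq => //; exact: (continuousN (cc _)).
Qed.

Lemma continuous_qdot f g t : {for t, continuous f} -> {for t, continuous g} ->
  {for t, continuous (fun u => qdot (f u) (g u))}.
Proof.
move=> cf cg; have -> : (fun u => qdot (f u) (g u)) =
    (fun u => (f u *q qconj (g u)) 0 0).
  apply/funext => u; rewrite qdotE /qmul /qconj !mkqE; ring.
by apply/continuous_coord/continuous_qmul => //; exact: continuous_qconj.
Qed.

End Continuity.

Lemma S3_compact (R : realType) : compact (@S3 R).
Proof.
apply: bounded_closed_compact.
  exists 1; split; first exact: real1.
  move=> M M1 x; rewrite /S3 /= => xS; apply: le_trans (ltW M1).
  by apply: le_trans (normr_le_qnorm x) _; rewrite /qnorm xS sqrtr1.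
rewrite (_ : S3 (R := R) = (fun x => qdot x x) @^-1` [set 1]) //.
apply: preimage_closed; last exact: closed_eq.
by move=> x _; apply: continuous_qdot; move=> ?.
Qed.

(** A solution is a fixed point of [F]. Since [F] strictly decreases distances without a uniform
    ratio, the fixed point is found by minimizing the displacement |p - F p| on the compact
    sphere. *)
Lemma fiber_map_surj (R : realType) (c s : R) (x y : quat R) :
  c ^+ 2 + s ^+ 2 = 1 -> s ^+ 2 <= 1 / 4 -> S3 x -> S3 y ->
  exists2 p, S3 p & fiber_map c s p x = y.
Proof.
move=> cs1 s_le xS yS.
pose F p := y *q conj_axis c s p *q qconj x.
have FS p : S3 p -> S3 (F p).
  by move=> pS; exact: (S3M (S3M yS (S3_conj_axis cs1 pS)) (S3V xS)).
have cF : continuous F.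
  move=> p; have cst a : {for p, continuous (fun=> a : quat R)}.
    by apply: cst_continuous.
  have cid : {for p, continuous (fun u : quat R => u)} by move=> ?.
  exact: (continuous_qmul (continuous_qmul (cst y) (continuous_qmul
    (continuous_qmul cid (cst _)) (continuous_qconj cid))) (cst _)).
pose G (p : quat R) := qdot (p - F p) (p - F p).
have cG : continuous G.
  move=> p; have cid : {for p, continuous (fun u : quat R => u)} by move=> ?.
  have cB : {for p, continuous (fun u : quat R => u - F u)}.
    exact: (continuousB cid (cF p)).
  exact: (continuous_qdot cB cB).
have S3_neq0 : S3 (R := R) !=set0 by exists (q1 R); exact: S3_1.
have [p pS pmin] :=
  EVT_min_rV S3_neq0 (@S3_compact R) (continuous_subspaceT cG).
move: pS; rewrite inE => pS; exists p => //.
suff pF : p = F p.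
  rewrite /fiber_map {1}pF /F S3_mulqVK // S3_mulqK //; exact: S3_conj_axis.
(* If the minimizer moved, [F p] would have a strictly smaller displacement. *)
apply: contrapT => pF.
have := pmin (F p); rewrite inE /G => /(_ (FS _ pS)).
apply/negP; rewrite -ltNge.
have -> : F p - F (F p) =
    y *q (conj_axis c s p - conj_axis c s (F p)) *q qconj x.
  by rewrite qmulBr qmulBl.
rewrite qdotMr qdotMl qdot_conj; move: (xS) (yS); rewrite {1 2}/S3 /= => -> ->.
by rewrite !mul1r; apply: sqr_dist_conj_axis_lt => //; exact: FS.
Qed.

(** * Isometries *)

Section SmoothLinear.
Variables (R : realType) (V W : normedModType R).

Lemma Ck_on_cst k (U : set V) (a : W) : Ck_on k U (fun=> a).
Proof.
elim: k a => [|k IHk] a /=; first by move=> x _; exact: cst_continuous.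
split=> [x _|v]; first exact: differentiable_cst.
rewrite (_ : (fun x => _) = fun=> 0); first exact: IHk.
by apply/funext => x; rewrite diff_cst.
Qed.

(** The differential of a continuous linear map does not depend on the base point, so each
    directional derivative is constant. *)
Lemma smooth_on_linear (f : {linear V -> W}) (U : set V) :
  continuous f -> smooth_on U f.
Proof.
move=> cf [|k] /=; first by move=> x _; exact: cf.
split=> [x _|v]; first exact: linear_differentiable.
rewrite (_ : (fun x => _) = fun=> f v); first exact: Ck_on_cst.
by apply/funext => x; rewrite diff_lin.
Qed.

Lemma smooth_extension_at_linear (f : {linear V -> W}) (M : set V) z :
  continuous f -> smooth_extension_at M f z f.
Proof.
move=> cf; exists setT; split => //; first exact: open_nbhsT.
exact: smooth_on_linear.
Qed.

End SmoothLinear.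

(** * Isometries that permute the fibers *)

Section Isometry.
Variable R : realType.
Implicit Types (g : quat R) (z w : H2 R).

(** For unit [g] it carries the fiber of p to the fiber of g p. Being linear on the ambient space,
    it is its own smooth extension and its own differential. *)
Definition twist g z : H2 R := (z.1 *q qconj g, g *q z.2 *q qconj g).

Lemma twist_linear g : linear (twist g).
Proof.
by move=> k z w; congr pair;
  rewrite /= ?qmulDr !qmulDl ?qmulZr ?qmulZl ?qmulZl.
Qed.

HB.instance Definition _ g :=
  GRing.isLinear.Build R (H2 R) (H2 R) _ (twist g) (twist_linear g).

Lemma twist_continuous g : continuous (twist g).
Proof.
move=> z.
have c1 : {for z, continuous (fun w : H2 R => w.1)} by exact: cvg_fst.
have c2 : {for z, continuous (fun w : H2 R => w.2)} by exact: cvg_snd.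
have cst a : {for z, continuous (fun=> a : quat R)} by apply: cst_continuous.
exact: (cvg_pair (continuous_qmul c1 (cst (qconj g)))
  (continuous_qmul (continuous_qmul (cst g) c2) (cst (qconj g)))).
Qed.

Lemma dot2_twist g z w : S3 g -> dot2 (twist g z) (twist g w) = dot2 z w.
Proof.
rewrite /S3 /= /dot2 => gS.
by rewrite !qdotMr qdotMl qdot_conj gS !mul1r.
Qed.

Lemma S3xS3_twist g : S3 g -> set_fun (@S3xS3 R) (@S3xS3 R) (twist g).
Proof.
move=> gS z [z1S z2S]; split; first exact: S3M z1S (S3V gS).
exact: (S3M (S3M gS z2S) (S3V gS)).
Qed.

Lemma twistK g : S3 g -> cancel (twist g) (twist (qconj g)).
Proof.
move=> gS [x y]; rewrite /twist /= qconjK S3_mulqVK // -!qmulA.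
by rewrite S3_mulVq // qmulq1 S3_mulKq.
Qed.

Lemma isometry_twist g : S3 g -> isometry_S3xS3 (twist g).
Proof.
move=> gS; split.
  exists (twist (qconj g)); split.
  - move=> z _; exists (twist g).
    exact/smooth_extension_at_linear/twist_continuous.
  - move=> z _; exists (twist (qconj g)).
    exact/smooth_extension_at_linear/twist_continuous.
  - by split; apply: S3xS3_twist => //; exact: S3V.
  - by move=> z _; exact: twistK.
  - by move=> z _; rewrite -{1}(qconjK g) twistK //; exact: S3V.
move=> z _; exists (twist g); split.
  exact/smooth_extension_at_linear/twist_continuous.
move=> u v _ _; rewrite (diff_lin _ (@twist_continuous g)).
exact: dot2_twist.
Qed.

End Isometry.

(** * Homogeneity of the family, and its members as great spheres *)

Section Sigma.
Variables (R : realType) (alpha : R).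
Implicit Types (p x y g : quat R).

Let fmap := fiber_map (cos alpha) (sin alpha).

Lemma SigmaE p : S3 p -> Sigma alpha p = [set (x, fmap p x) | x in @S3 R].
Proof.
move=> pS; rewrite /Sigma /f_alpha (qinvE pS) qinvE //.
by apply: S3_conj_axis => //; exact: cos2Dsin2.
Qed.

Lemma conj_axisM c s g p :
  conj_axis c s (g *q p) = g *q conj_axis c s p *q qconj g.
Proof. by rewrite /conj_axis qconjM !qmulA. Qed.

Lemma twist_Sigma g p : S3 g -> S3 p ->
  twist g @` Sigma alpha p = Sigma alpha (g *q p).
Proof.
move=> gS pS; rewrite !SigmaE //; last exact: S3M.
(* The equivariance f(g p) = g f(p) g^-1 makes the inner factors g cancel. *)
have fmapE x : fmap (g *q p) (x *q qconj g) = g *q fmap p x *q qconj g.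
  rewrite /fmap /fiber_map conj_axisM !qconjM qconjK !qmulA.
  by rewrite (S3_mulqVK _ gS).
apply/seteqP; split=> [_ [_ [x xS <-] <-]|_ [x xS <-]].
  by exists (x *q qconj g); [exact: (S3M xS (S3V gS)) | rewrite fmapE].
exists (x *q g, fmap p (x *q g)).
  by exists (x *q g) => //; exact: S3M.
by rewrite /twist /= -fmapE S3_mulqK.
Qed.

Lemma Sigma_homogeneous :
  fiberwise_homogeneous [set Sigma alpha p | p in @S3 R].
Proof.
move=> _ _ [p pS <-] [q qS <-].
(* Left multiplication by q p^-1 takes p to q. *)
have gS : S3 (q *q qconj p) by exact: (S3M qS (S3V pS)).
exists (twist (q *q qconj p)); split; first exact: isometry_twist.
  move=> _ [r rS <-]; exists (q *q qconj p *q r); first exact: S3M.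
  by rewrite twist_Sigma.
by rewrite twist_Sigma // S3_mulqVK.
Qed.

Lemma fmap_linear p : linear (fmap p).
Proof.
by move=> k x y; rewrite /fmap /fiber_map qmulDr !qmulDl qmulZr !qmulZl.
Qed.

(** [fmap p] is linear on all quaternions and preserves the norm, so the 4-dimensional subspace is
    its full graph. *)
Lemma great_S3_Sigma p : S3 p -> great_S3 (Sigma alpha p).
Proof.
move=> pS; have cs1 : cos alpha ^+ 2 + sin alpha ^+ 2 = 1 := cos2Dsin2 _.
have graph_linear : linear (fun x => (x, fmap p x) : H2 R).
  by move=> k x y; congr pair; rewrite /= fmap_linear.
pose graphM := GRing.isLinear.Build _ _ _ _ _ graph_linear.
pose graph : {linear quat R -> H2 R} :=
  HB.pack (fun x => (x, fmap p x) : H2 R) graphM.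
have qdot_fmap x : qdot (fmap p x) (fmap p x) = qdot x x.
  have := S3_conj_axis cs1 pS; move: pS; rewrite /S3 /= => pS fpS.
  by rewrite /fmap /fiber_map qdotMr qdotMl qdot_conj pS fpS !mul1r.
rewrite SigmaE //; split.
  by move=> _ [x xS <-]; split; last exact: S3_fiber_map.
exists (limg (linfun graph)); split.
  (* The graph map has trivial kernel because its first coordinate is x itself. *)
  rewrite limg_dim_eq ?dimvf ?dim_matrix //; apply/eqP; rewrite -subv0.
  apply/subvP => x; rewrite memv_cap memv_ker lfunE /= memv0 => /andP[_].
  by move=> /eqP[->].
have sqrt2_neq0 : Num.sqrt 2 != 0 :> R by rewrite sqrtr_eq0 -ltNge.
have sqrt2K : Num.sqrt 2 ^+ 2 = 2 :> R by rewrite sqr_sqrtr.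
apply/seteqP; split=> [_ [_ [x xS <-] <-]|w [w1 /memv_imgP[x _]]].
  split; last first.
    have -> : clifford (x, fmap p x) = linfun graph ((Num.sqrt 2)^-1 *: x).
      by rewrite lfunE linearZ.
    by rewrite memv_img ?memvf.
  rewrite /dot2 /clifford /= !qdotZ qdot_fmap; move: xS; rewrite /S3 /= => ->.
  by rewrite exprVn sqrt2K; field.
rewrite lfunE /= => wE; move: w1; rewrite wE /dot2 /= qdot_fmap => x1.
(* A unit vector (x, [fmap p x]) has 2 |x|^2 = 1, so rescaling by the square root of 2 lands on the
   unit sphere. *)
exists (Num.sqrt 2 *: x, fmap p (Num.sqrt 2 *: x)).
  exists (Num.sqrt 2 *: x) => //.
  by rewrite /S3 /= qdotZ sqrt2K mulr_natl mulr2n.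
have -> : (Num.sqrt 2 *: x, fmap p (Num.sqrt 2 *: x)) =
  graph (Num.sqrt 2 *: x) by [].
by rewrite linearZ /clifford scalerA mulVf // scale1r.
Qed.

End Sigma.

(** * Bundle structure *)

Section Fibration.
Variables (R : realType) (alpha : R).
Hypothesis sin_le : sin alpha ^+ 2 <= 1 / 4.

Let fmap := fiber_map (cos alpha) (sin alpha).
Let cs1 : cos alpha ^+ 2 + sin alpha ^+ 2 = 1 := cos2Dsin2 alpha.
Let S3t : topologicalType := set_type (@S3 R).
(** Default value for the choices in [proj] and [fst3], and the point at which [sect] is evaluated
    to show that [proj] is onto. *)
Let one : S3t := exist _ (q1 R) (mem_set (@S3_1 R)).

Let S3t_P (p : S3t) : S3 (\val p).
Proof. exact: set_mem (valP p). Qed.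

(** The bundle projection: the parameter of the fiber through [z], meaningful on the product of
    spheres. *)
Let proj (z : H2 R) : S3t := xget one [set p | fmap (\val p) z.1 = z.2].
Let fst3 (z : H2 R) : S3t := xget one [set x | \val x = z.1].
(** Inverse of the trivialization given by [proj] and [fst3]. *)
Let sect (b : S3t * S3t) : H2 R := (\val b.2, fmap (\val b.1) (\val b.2)).

Let projP z : S3xS3 z -> fmap (\val (proj z)) z.1 = z.2.
Proof.
move=> [z1S z2S]; have [p pS pz] := fiber_map_surj cs1 sin_le z1S z2S.
by have := @xgetPex _ one [set p | fmap (\val p) z.1 = z.2]; apply;
  exists (exist _ p (mem_set pS)).
Qed.

Let fst3P z : S3xS3 z -> \val (fst3 z) = z.1.
Proof.
move=> [z1S _]; have := @xgetPex _ one [set x | \val x = z.1]; apply.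
by exists (exist _ z.1 (mem_set z1S)).
Qed.

Let proj_eq z p : S3xS3 z -> S3 p -> fmap p z.1 = z.2 -> \val (proj z) = p.
Proof.
move=> zM pS pz; have [z1S _] := zM.
by apply: (fiber_map_inj cs1 sin_le (S3t_P _) pS z1S); rewrite -/fmap projP.
Qed.

Let S3xS3_sect b : S3xS3 (sect b).
Proof. by split; [exact: S3t_P | exact: S3_fiber_map]. Qed.

Let continuous_to_S3t (f : H2 R -> S3t) :
  {within @S3xS3 R, continuous (fun z => \val (f z))} ->
  {within @S3xS3 R, continuous f}.
Proof.
by move=> cf; apply: (@continuous_comp_initial _ (subspace _) _ set_val f).
Qed.

Let continuous_proj : {within @S3xS3 R, continuous proj}.
Proof.
apply: continuous_to_S3t; apply/subspace_continuousP => z zM.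
apply/cvgrPdist_lt => e e_gt0; rewrite near_withinE.
(* The Hölder estimate has factor 8, and each of its two Euclidean distances is at most twice the
   matrix norm: 8 * (2 + 2) = 32. *)
have d_gt0 : 0 < e ^+ 3 / 32 by rewrite divr_gt0 ?exprn_gt0.
apply/nbhs_ballP; exists (e ^+ 3 / 32) => // w zw wM.
have [z1S z2S] := zM; have [w1S w2S] := wM.
have [zw1 zw2] : `|z.1 - w.1| < e ^+ 3 / 32 /\ `|z.2 - w.2| < e ^+ 3 / 32.
  by move: zw => -[]; rewrite -!ball_normE.
apply: le_lt_trans (normr_le_qnorm _) _.
rewrite -(ltr_pXn2r (n := 3)) ?nnegrE ?qnorm_ge0 ?(ltW e_gt0) //.
apply: (le_lt_trans (qnorm_fiber_map_inverse_bound cs1 sin_le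
  (S3t_P _) (S3t_P _) z1S w1S)).
rewrite -/fmap !projP //.
have := qnorm_le_normr (z.1 - w.1); have := qnorm_le_normr (z.2 - w.2); lra.
Qed.

Let continuous_fst3 : {within @S3xS3 R, continuous fst3}.
Proof.
apply: continuous_to_S3t.
apply: (@subspace_eq_continuous _ _ _ (fun z => z.1)).
  by move=> z /set_mem zM; exact/esym/fst3P.
by apply: continuous_subspaceT => z; exact: cvg_fst.
Qed.

Let continuous_sect : continuous sect.
Proof.
move=> b.
have c1 : {for b, continuous (fun b : S3t * S3t => \val b.1)}.
  apply: (@continuous_comp _ _ _ fst set_val); first exact: cvg_fst.
  exact: initial_continuous.
have c2 : {for b, continuous (fun b : S3t * S3t => \val b.2)}.
  apply: (@continuous_comp _ _ _ snd set_val); first exact: cvg_snd.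
  exact: initial_continuous.
have cst : {for b, continuous (fun=> mkq (cos alpha) (sin alpha) 0 0)}.
  by apply: cst_continuous.
exact: (cvg_pair c2 (continuous_qmul (continuous_qmul c1 c2) (continuous_qconj
  (continuous_qmul (continuous_qmul c1 cst) (continuous_qconj c1))))).
Qed.

Let proj_sect b : proj (sect b) = b.1.
Proof. by apply: val_inj; apply: proj_eq. Qed.

Let fst3_sect b : fst3 (sect b) = b.2.
Proof. by apply: val_inj; rewrite fst3P. Qed.

Lemma is_fibration_Sigma :
  is_fibration (@S3xS3 R) [set Sigma alpha p | p in @S3 R].
Proof.
have fiberE (p : S3t) : @S3xS3 R `&` proj @^-1` [set p] = Sigma alpha (\val p).
  rewrite SigmaE; last exact: S3t_P.
  apply/seteqP; split => [[x y] [xyM /= <-]|_ [x xS <-]].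
    by exists x; [case: xyM | rewrite -/fmap (projP xyM)].
  have := proj_sect (p, exist _ x (mem_set xS)).
  have := S3xS3_sect (p, exist _ x (mem_set xS)).
  by rewrite /sect.
exists S3t, S3t, proj; split; last first.
  apply/seteqP; split => [_ [p pS <-]|_ [p _ <-]].
    by exists (exist _ p (mem_set pS)) => //; rewrite fiberE.
  by exists (\val p); [exact: S3t_P | rewrite fiberE].
split; first exact: continuous_proj.
  apply/seteqP; split => // p _.
  exists (sect (p, one)); first exact: S3xS3_sect.
  by rewrite proj_sect.
(* One global chart serves every base point. *)
move=> b; exists setT; split; first exact: open_nbhsT.
exists (fun z => (proj z, fst3 z)), sect.
rewrite preimage_setT setIT setXTT; split => //.
- by move=> z; exact: (cvg_pair (@continuous_proj z) (@continuous_fst3 z)).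
- exact: continuous_subspaceT continuous_sect.
- by split=> [z _|b' _] //; exact: S3xS3_sect.
- split=> [z /set_mem zM|b' _]; last first.
    by rewrite proj_sect fst3_sect -surjective_pairing.
  by rewrite /sect /= fst3P // projP // -surjective_pairing.
Qed.

End Fibration.

(** * Comparison with Hopf fibrations *)

Section NotHopf.
Variables (R : realType) (alpha : R).
Hypotheses (alpha_gt0 : 0 < alpha) (alpha_le : alpha <= pi / 6).

(** The triple-angle formula gives 3 s - 4 s^3 = sin (pi / 2) = 1, that is (s + 1) (2 s - 1)^2 = 0,
    and s is positive. *)
Lemma sin_pi6 : sin (pi / 6) = 1 / 2 :> R.
Proof.
set x : R := pi / 6.
have x_itv : 0 < x < pi.
  by rewrite divr_gt0 ?pi_gt0 // ltr_pdivrMr // ltr_pMr ?pi_gt0 // ltr1n.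
have s_gt0 : 0 < sin x by exact: sin_gt0_pi.
have s3 : sin (x + (x + x)) = 1.
  by rewrite -(sin_pihalf R); congr sin; rewrite /x; field.
have c2 : cos x ^+ 2 = 1 - sin x ^+ 2 by rewrite -(cos2Dsin2 x) addrK.
have s3E : 3 * sin x - 4 * sin x ^+ 3 = 1.
  transitivity (3 * sin x * cos x ^+ 2 - sin x ^+ 3); first by rewrite c2; ring.
  by rewrite -[RHS]s3 !sinD cosD; ring.
have : (sin x + 1) * (2 * sin x - 1) ^+ 2 = 0.
  by transitivity (1 - (3 * sin x - 4 * sin x ^+ 3)); [ring |
    rewrite s3E subrr].
move/eqP; rewrite mulf_eq0 gt_eqF ?addr_gt0 //= sqrf_eq0 subr_eq0 => /eqP s2.
lra.
Qed.

Lemma sin_alpha_gt0 : 0 < sin alpha.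
Proof.
apply: sin_gt0_pi; rewrite alpha_gt0 (le_lt_trans alpha_le) //.
by rewrite ltr_pdivrMr // ltr_pMr ?pi_gt0 // ltr1n.
Qed.

Lemma sqr_sin_alpha_le : sin alpha ^+ 2 <= 1 / 4.
Proof.
have -> : 1 / 4 = (1 / 2) ^+ 2 :> R by field.
rewrite ler_pXn2r ?nnegrE ?(ltW sin_alpha_gt0) // -sin_pi6.
have pi0 := pi_gt0 R; have a0 := alpha_gt0; have a6 := alpha_le.
rewrite leNgt ltr_sin -?leNgt // in_itv /=; lra.
Qed.

(** If the graphs of x -> p x f^-1 and x -> u x w^-1 coincide, then t = u^-1 p satisfies t x = x
    (w^-1 f) for all unit x. Hence t is central, so real, and f = t w. *)
Lemma hopf_conj_axis :
  is_hopf_fibration [set Sigma alpha p | p in @S3 R] ->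
  exists w : quat R, forall p, S3 p -> exists k : R,
    conj_axis (cos alpha) (sin alpha) p = k *: w.
Proof.
move=> [a [b [c [d [aS bS cS dS FibE]]]]].
(* Solving x = a y b^-1 for y turns c v y d^-1 into (c v a^-1) x (d b^-1)^-1; only the left factor
   depends on the fiber. *)
exists (d *q qconj b) => p pS.
set f := conj_axis _ _ p.
have fS : S3 f by apply: S3_conj_axis => //; exact: cos2Dsin2.
have [_ [v vS <-] SigmaEv] :
  [set two_sided a b c d @` A | A in @standard_hopf R]
  (Sigma alpha p) by rewrite -FibE; exists p.
pose u := c *q v *q qconj a; pose w := d *q qconj b.
have uS : S3 u by exact: (S3M (S3M cS vS) (S3V aS)).
have uw x : S3 x -> p *q x *q qconj f = u *q x *q qconj w.
  move=> xS; have : Sigma alpha p (x, fiber_map (cos alpha) (sin alpha) p x).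
    by rewrite SigmaE //; exists x.
  rewrite -SigmaEv => -[_ [y yS <-]]; rewrite /two_sided /= !qinvE // => -[xE].
  rewrite /fiber_map -/f => <-; rewrite -xE /u /w qconjM qconjK !qmulA.
  by rewrite (S3_mulqVK _ aS) (S3_mulqVK _ bS).
pose t := qconj u *q p.
have tw x : S3 x -> t *q x = x *q (qconj w *q f).
  move=> xS; rewrite /t -!qmulA -[p *q x](S3_mulqVK _ fS) uw //.
  by rewrite -(qmulA u x) -(qmulA u) S3_mulKq // -qmulA.
(* Evaluation at x = 1 identifies the two factors, so [tw] says that [t] commutes with every unit
   quaternion. *)
have tE : t = qconj w *q f.
  by rewrite -[LHS]qmulq1 tw ?qmul1q //; exact: S3_1.
exists (t 0 0); have wS : S3 w by exact: (S3M dS (S3V bS)).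
rewrite -/w -[f](S3_mulVKq _ wS) -tE {1}(@central_quat _ t) ?qmulZr ?qmulq1 //.
by move=> x xS; rewrite tw // -tE.
Qed.

(** At p = 1 and p = j the axis is cos alpha + i sin alpha and cos alpha - i sin alpha. Both are
    multiples of one [w] only if cos alpha sin alpha = 0; as the sine is positive, the cosine
    vanishes, against sin^2 alpha <= 1/4. *)
Lemma not_hopf_Sigma : ~ is_hopf_fibration [set Sigma alpha p | p in @S3 R].
Proof.
move=> /hopf_conj_axis[w wP].
have jS : S3 (mkq 0 0 1 0 : quat R) by rewrite /S3 /= qdotE !mkqE; ring.
have [k kE] := wP _ (S3_1 R); have [l lE] := wP _ jS.
have k0 := congr1 (fun x : quat R => x 0 0) kE.
have k1 := congr1 (fun x : quat R => x 0 1) kE.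
have l0 := congr1 (fun x : quat R => x 0 0) lE.
have l1 := congr1 (fun x : quat R => x 0 1) lE.
move: l1 l0 k1 k0.
cbv beta; rewrite /conj_axis /qmul /qconj /q1 ?(mkqE, mxE) => l1 l0 k1 k0.
have s_gt0 := sin_alpha_gt0; have s_le := sqr_sin_alpha_le.
have cs1 := cos2Dsin2 alpha.
have cs0 : cos alpha * sin alpha = 0.
  have kl : (k * w 0 0) * (l * w 0 1) = (k * w 0 1) * (l * w 0 0) by ring.
  by move: kl; rewrite -l1 -l0 -k1 -k0; lra.
move/eqP: cs0; rewrite mulf_eq0 (gt_eqF s_gt0) orbF => /eqP c0.
by move: cs1; rewrite c0; lra.
Qed.
End NotHopf.

Theorem theorem2p5 (R : realType) (alpha : R)
    (alpha_gt0 : 0 < alpha) (alpha_le : alpha <= pi / 6) :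
  let Fib := [set Sigma alpha p | p in @S3 R] in
  [/\ is_fibration (@S3xS3 R) Fib,
      fiberwise_homogeneous Fib,
      (forall A, Fib A -> great_S3 A) &
      ~ is_hopf_fibration Fib].
Proof.
have sin_le := sqr_sin_alpha_le alpha_gt0 alpha_le.
move=> Fib; split.
- exact: is_fibration_Sigma.
- exact: Sigma_homogeneous.
- by move=> _ [p pS <-]; exact: great_S3_Sigma.
- exact: not_hopf_Sigma.
Qed.
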